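(* Let $M = [A,B]$ be an $n\times n$ double-complex matrix, where $A,B$ are $n \times n$ complex matrices. If $M$ is invertible, then $M$ has a Jordan SVD.
   Context: A double-complex number is a number of the form $w + zj$ with $w,z\in\mathbb{C}$, where $j^2=+1$ and multiplication is the commutative one $(w+zj)(w'+z'j) = ww'+zz' + j(wz'+zw')$. Conjugation is $(w+zj)^* = w - zj$ (with no complex conjugation of $w$ and $z$). A double-complex matrix is a matrix with double-complex entries; $M^*$ denotes its conjugate-transpose with respect to this conjugation. For $n\times n$ complex matrices $A,B$ define $[A,B] = A\frac{1+j}{2} + B^T\frac{1-j}{2}$ (with the plain transpose of $B$); every $n\times n$ double-complex matrix can be uniquely written in this form. One has $[A,B]+[C,D]=[A+C,B+D]$, $[A,B][C,D]=[AC,DB]$ and $[A,B]^*=[B,A]$. A square double-complex matrix $U$ is unitary if $U^*U = I$; equivalently $U=[P,P^{-1}]$ for some invertible complex matrix $P$. A complex Jordan matrix is a block diagonal matrix whose diagonal blocks are Jordan blocks $J_k(\lambda)$ ($k\ge 1$, $\lambda\in\mathbb{C}$), where $J_k(\lambda)$ is the $k \times k$ matrix with $\lambda$ on the diagonal, $1$ on the superdiagonal and $0$ elsewhere. A Jordan SVD of a double-complex matrix $M$ is a factorisation $M = U[J,J]V^*$ where $J$ is a complex Jordan matrix and $U$ and $V$ are unitary double-complex matrices. *)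

(* Defs.v *)
From HB Require Import structures.
From mathcomp Require Import all_boot all_order all_algebra.
From mathcomp Require Import ring.
From mathcomp Require Import reals.
From mathcomp Require Import complex.

Set Implicit Arguments.
Unset Strict Implicit.
Unset Printing Implicit Defensive.

Import Order.TTheory GRing.Theory Num.Theory.
Local Open Scope ring_scope.

(* [DComplex w z] stands for w + z j with j ^+ 2 = 1.  A dedicated type is
   used because the product type R[i] * R[i] already carries the
   componentwise ring structure. *)
Record dcomplex (R : realType) := DComplex { dc_re : R[i]; dc_im : R[i] }.

Section DComplexRing.
Variable R : realType.
Local Notation D := (dcomplex R).
Implicit Types x y z : D.

Definition dc_pair x := (dc_re x, dc_im x).
Definition pair_dc (p : R[i] * R[i]) : D := DComplex p.1 p.2.

Lemma dc_pairK : cancel dc_pair pair_dc. Proof. by case. Qed.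

HB.instance Definition _ := Choice.copy D (can_type dc_pairK).

Definition dc_add x y := DComplex (dc_re x + dc_re y) (dc_im x + dc_im y).
Definition dc_opp x := DComplex (- dc_re x) (- dc_im x).
Definition dc_mul x y :=
  DComplex (dc_re x * dc_re y + dc_im x * dc_im y)
           (dc_re x * dc_im y + dc_im x * dc_re y).

Lemma dc_addA : associative dc_add.
Proof. by move=> [a b] [c d] [e f]; congr DComplex; rewrite /= addrA. Qed.

Lemma dc_addC : commutative dc_add.
Proof. by move=> [a b] [c d]; congr DComplex; rewrite /= addrC. Qed.

Lemma dc_add0 : left_id (DComplex 0 0) dc_add.
Proof. by move=> [a b]; congr DComplex; rewrite /= add0r. Qed.

Lemma dc_addN : left_inverse (DComplex 0 0) dc_opp dc_add.
Proof. by move=> [a b]; congr DComplex; rewrite /= addNr. Qed.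

HB.instance Definition _ :=
  GRing.isZmodule.Build D dc_addA dc_addC dc_add0 dc_addN.

Lemma dc_mulA : associative dc_mul.
Proof. by move=> [a b] [c d] [e f]; congr DComplex => /=; ring. Qed.

Lemma dc_mulC : commutative dc_mul.
Proof. by move=> [a b] [c d]; congr DComplex => /=; ring. Qed.

Lemma dc_mul1 : left_id (DComplex 1 0) dc_mul.
Proof. by move=> [a b]; congr DComplex => /=; ring. Qed.

Lemma dc_mulD : left_distributive dc_mul dc_add.
Proof. by move=> [a b] [c d] [e f]; congr DComplex => /=; ring. Qed.

Lemma dc_oner_neq0 : DComplex 1 0 != 0 :> D.
Proof. by apply/eqP => -[] /eqP; rewrite oner_eq0. Qed.

HB.instance Definition _ := GRing.Zmodule_isComNzRing.Build D
  dc_mulA dc_mulC dc_mul1 dc_mulD dc_oner_neq0.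

(* (w + z j) (w - z j) = w ^+ 2 - z ^+ 2 is a complex number, and w + z j is
   invertible exactly when it is nonzero. *)
Definition dc_norm x : R[i] := dc_re x ^+ 2 - dc_im x ^+ 2.

Definition dc_unit : pred D := [pred x | dc_norm x != 0].

Definition dc_inv x : D :=
  if dc_norm x != 0 then DComplex (dc_re x / dc_norm x) (- dc_im x / dc_norm x)
  else x.

Lemma dc_mulVx : {in dc_unit, left_inverse 1 dc_inv *%R}.
Proof.
move=> [a b]; rewrite inE /dc_inv => /[dup] nz ->.
by congr DComplex => /=; rewrite /dc_norm /= in nz *; field.
Qed.

Lemma dc_unitPl x y : y * x = 1 -> dc_unit x.
Proof.
case: x y => [a b] [c d] [e1 e2]; rewrite /dc_unit /dc_norm /=.
have e : (c ^+ 2 - d ^+ 2) * (a ^+ 2 - b ^+ 2) = 1.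
  transitivity ((c * a + d * b) ^+ 2 - (c * b + d * a) ^+ 2); first by ring.
  by rewrite e1 e2; ring.
by apply/eqP => e0; move/eqP: e; rewrite e0 mulr0 eq_sym oner_eq0.
Qed.

Lemma dc_inv_out : {in [predC dc_unit], dc_inv =1 id}.
Proof. by move=> x; rewrite inE /= negbK /dc_inv => /eqP->; rewrite eqxx. Qed.

HB.instance Definition _ := GRing.ComNzRing_hasMulInverse.Build D
  dc_mulVx dc_unitPl dc_inv_out.

End DComplexRing.

Section DoubleComplexMatrices.
Variable R : realType.
Local Notation C := R[i].
Local Notation D := (dcomplex R).

Definition dc_of (w : C) : D := DComplex w 0.

Definition dc_j : D := DComplex 0 1.

Definition dc_conj (x : D) : D := DComplex (dc_re x) (- dc_im x).

Definition dc_adjmx m n (M : 'M[D]_(m, n)) : 'M[D]_(n, m) := map_mx dc_conj M^T.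

Definition dc_pairmx n (A B : 'M[C]_n) : 'M[D]_n :=
  ((1 + dc_j) / 2%:R) *: map_mx dc_of A + ((1 - dc_j) / 2%:R) *: map_mx dc_of B^T.

Definition dc_unitarymx n (U : 'M[D]_n) : Prop := dc_adjmx U *m U = 1%:M.

Definition jordan_block k (a : C) : 'M[C]_k :=
  \matrix_(i, j) if i == j then a else (i.+1 == j)%:R.

(* The order [n] is only propositionally equal to the sum of the orders
   [k i] of the blocks, hence the cast. *)
Definition is_jordan_mx n (J : 'M[C]_n) : Prop :=
  exists (m : nat) (k : 'I_m -> nat) (a : 'I_m -> C),
    (forall i, (0 < k i)%N) /\
    exists e : (\sum_(i < m) k i)%N = n,
      J = castmx (e, e) (\mxdiag_(i < m) jordan_block (k i) (a i)).

Definition has_jordan_svd n (M : 'M[D]_n) : Prop :=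
  exists (U V : 'M[D]_n) (J : 'M[C]_n),
    [/\ dc_unitarymx U, dc_unitarymx V, is_jordan_mx J
      & M = U *m dc_pairmx J J *m dc_adjmx V].

End DoubleComplexMatrices.

(* Main.v *)
Require Import Defs.
From HB Require Import structures.
From mathcomp Require Import all_boot all_order all_algebra.
From mathcomp Require Import ring zify.
From mathcomp Require Import reals.
From mathcomp Require Import complex.

(** With U = [X, X^-1] and V = [Y, Y^-1], the factorisation
    [A, B] = U [J, J] V^* says that A = X J Y^-1 and B = Y J X^-1.  In
    particular A B = X J^2 X^-1, so X must conjugate a square root of A B to
    Jordan form.  Conversely, let S be any square root of A B, let J be its
    Jordan form, S = X J X^-1, and put Y = A^-1 X J: the first equation holds
    by the choice of Y, and the second because
    Y J X^-1 = A^-1 (X J^2 X^-1) = A^-1 A B = B.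
    When [A, B] is invertible so are A and B (unit_pairmx), hence S, J and Y,
    and U and V are indeed unitary (unitary_pairmx).

    Two facts on complex matrices remain.  An invertible matrix has a square
    root (unitmx_sqrt): modulo its characteristic polynomial, whose roots are
    nonzero, X is the square of a polynomial, which is built one root at a time
    (sqrt_X_mod_prod_XsubC).  Every matrix is similar to a Jordan matrix
    (jordan_form): a Jordan block whose order is the full multiplicity of an
    eigenvalue in the minimal polynomial has an invariant complement
    (split_jordan_block), and induction applies to the complement. *)

Set Implicit Arguments.
Unset Strict Implicit.
Unset Printing Implicit Defensive.

Import GRing.Theory Num.Theory.
Local Open Scope ring_scope.

(** * Square roots of invertible matrices *)

(** Let q be a solution modulo p and z a further root.  Every q + c p is still
    a solution modulo p, as (q + c p)^2 - X = (s + 2 q c + p c^2) p for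
    s = (q^2 - X) / p, so c need only make the first factor vanish at z.  If
    p(z) = 0 this is a linear equation for c, with coefficient
    2 q(z) <> 0 since q(z)^2 = z; otherwise it is solved by making
    q(z) + c p(z) a square root of z. *)
Lemma sqrt_X_mod_prod_XsubC (F : numClosedFieldType) (r : seq F) :
  all (predC1 0) r ->
  exists q : {poly F}, \prod_(z <- r) ('X - z%:P) %| q ^+ 2 - 'X.
Proof.
elim: r => [|z r IHr] /=; first by exists 0; rewrite big_nil dvd1p.
case/andP=> nz0 /IHr [q]; rewrite big_cons; set p := \prod_(_ <- _) _.
case/dvdpP=> s def_s.
suff [c rc]: exists c, root (s + (q *+ 2) * c%:P + p * c%:P ^+ 2) z.
  exists (q + p * c%:P).
  have ->: (q + p * c%:P) ^+ 2 - 'X =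
           (s + (q *+ 2) * c%:P + p * c%:P ^+ 2) * p.
    transitivity ((q ^+ 2 - 'X) + p * ((q *+ 2) * c%:P + p * c%:P ^+ 2)).
      by ring.
    by rewrite def_s; ring.
  by apply: dvdp_mul => //; rewrite dvdp_XsubCl.
have def_sz : q.[z] ^+ 2 - z = s.[z] * p.[z].
  by have := congr1 (horner^~ z) def_s; rewrite !hornerE.
have [pz0|pz_neq0] := eqVneq p.[z] 0; last first.
  have [w e] : exists w : F, w ^+ 2 = z by exists (2.-root z); rewrite rootCK.
  (* This c makes the value of q + c p at z equal to w. *)
  exists ((w - q.[z]) / p.[z]); apply/rootP; rewrite !hornerE /=.
  transitivity ((s.[z] * p.[z] - q.[z] ^+ 2 + w ^+ 2) / p.[z]); first by field.
  by rewrite -def_sz e; ring.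
have qz0 : q.[z] != 0.
  move: def_sz; rewrite pz0 mulr0 => /eqP; rewrite subr_eq0 => /eqP e.
  by apply: contraNneq nz0 => qz; rewrite -e qz expr0n.
exists (- s.[z] / (q.[z] *+ 2)); apply/rootP; rewrite !hornerE pz0 /=.
by field.
Qed.

(** By Cayley-Hamilton, a square root of X modulo the characteristic polynomial
    of A evaluates at A to a square root of A. *)
Lemma unitmx_sqrt (F : numClosedFieldType) n (A : 'M[F]_n) :
  A \in unitmx -> exists S : 'M[F]_n, S *m S = A.
Proof.
case: n A => [|n] A uA; first by exists A; rewrite flatmx0 [RHS]flatmx0.
have [r def_r] := closed_field_poly_normal (char_poly A).
rewrite (monicP (char_poly_monic A)) scale1r in def_r.
have r_neq0 : all (predC1 0) r.
  apply/allP=> z rz /=; apply: contraTneq uA => z0.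
  have : root (char_poly A) 0 by rewrite def_r root_prod_XsubC -z0.
  rewrite unitmxE unitfE negbK /root horner_coef0 char_poly_det.
  by rewrite mulf_eq0 signr_eq0.
have [q /dvdpP[s def_s]] := sqrt_X_mod_prod_XsubC r_neq0.
exists (horner_mx A q); apply/eqP; rewrite -subr_eq0.
rewrite -[X in _ - X](horner_mx_X A) -[_ *m _]rmorphM -rmorphB /=.
by rewrite -expr2 def_s -def_r rmorphM /= Cayley_Hamilton mulr0.
Qed.

(** * Jordan normal form *)

(** The rows of V span an invariant subspace, and so does the annihilator of
    the columns of G, since A G = G J.  That V G is invertible says that G
    separates the row space of V, so that the two subspaces are
    complementary. *)
Lemma invariant_complement (F : fieldType) n k (A : 'M[F]_n) (J : 'M[F]_k)
    (V : 'M[F]_(k, n)) (G : 'M[F]_(n, k)) :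
  V *m A = J *m V -> A *m G = G *m J -> V *m G \in unitmx ->
  exists m (W : 'M[F]_(m, n)) (A' : 'M[F]_m),
    [/\ (k + m)%N = n, row_free (col_mx V W) & W *m A = A' *m W].
Proof.
move=> VA AG uVG.
have rG : \rank G = k.
  apply/eqP; rewrite eqn_leq rank_leq_col -{1}(mxrank_unit uVG).
  exact: mxrankM_maxr.
have WG : row_base (kermx G) *m G = 0 by apply/sub_kermxP; rewrite eq_row_base.
have [A' WA] : exists A', row_base (kermx G) *m A = A' *m row_base (kermx G).
  apply/submxP; rewrite eq_row_base; apply/sub_kermxP.
  by rewrite -mulmxA AG mulmxA WG mul0mx.
exists (\rank (kermx G)), (row_base (kermx G)), A'; split=> //.
  by rewrite mxrank_ker rG subnKC // -{1}rG rank_leq_row.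
rewrite -kermx_eq0; set K := kermx (col_mx _ _).
have := mulmx_ker (col_mx V (row_base (kermx G))); rewrite -/K.
rewrite -(hsubmxK K) mul_row_col => K0.
have K1 : lsubmx K = 0.
  apply: (can_inj (mulmxK uVG)); rewrite mul0mx.
  have := congr1 (mulmx^~ G) K0; rewrite /= mulmxDl.
  rewrite -[_ *m V *m G]mulmxA -[_ *m row_base _ *m G]mulmxA WG.
  by rewrite mulmx0 addr0 mul0mx.
have K2 : rsubmx K = 0.
  apply: (row_free_inj (row_base_free (kermx G))).
  by move: K0; rewrite K1 mul0mx add0r mul0mx.
by rewrite K1 K2 row_mx0.
Qed.

Section JordanForm.
Variable R : realType.
Local Notation C := R[i].

Lemma jordan_blockE k (a : C) : jordan_block k a = a%:M + jordan_block k 0.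
Proof.
by apply/matrixP=> i j; rewrite !mxE; case: eqP => _; rewrite ?addr0 ?add0r.
Qed.

(** A nilpotent Jordan block shifts rows up: it sends a chain of row vectors
    that ends in 0 to its successor. *)
Lemma mul_jordan_block0 k n (v : nat -> 'rV[C]_n) :
  v k = 0 ->
  jordan_block k 0 *m (\matrix_(i < k) v i) = \matrix_(i < k) v i.+1.
Proof.
move=> vk0; apply/matrixP=> i l; rewrite !mxE.
have [lt_ik|ge_ik] := ltnP i.+1 k.
  rewrite (bigD1 (Ordinal lt_ik)) //= big1 ?addr0 => [|j ne_j]; rewrite !mxE.
    by rewrite -val_eqE /= ltn_eqF // eqxx mul1r.
  case: eqP => _; rewrite ?mul0r //.
  have /negbTE-> : i.+1 != j by apply: contraNneq ne_j => e; apply/eqP/val_inj.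
  by rewrite mul0r.
have -> : i.+1 = k by apply/eqP; rewrite eqn_leq ltn_ord.
rewrite vk0 mxE big1 // => j _; rewrite !mxE; case: eqP => _; rewrite ?mul0r //.
by rewrite gtn_eqF ?mul0r // (leq_trans (ltn_ord j)).
Qed.

(** The column analogue; the chain is listed backwards because on the right a
    nilpotent Jordan block moves each column to the next position. *)
Lemma mul_mx_jordan_block0 k n (v : nat -> 'cV[C]_n) :
  v k = 0 ->
  (\matrix_(l < n, j < k) v (k.-1 - j)%N l 0) *m jordan_block k 0
    = \matrix_(l < n, j < k) v (k - j)%N l 0.
Proof.
move=> vk0; apply/matrixP=> l j; rewrite !mxE.
have [j0|j_gt0] := posnP j.
  rewrite j0 subn0 vk0 mxE big1 // => i _; rewrite !mxE j0 /=.
  by case: eqP => _; rewrite mulr0.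
have lt_jk : (j.-1 < k)%N by rewrite (leq_ltn_trans (leq_pred j)).
rewrite (bigD1 (Ordinal lt_jk)) //= big1 ?addr0 => [|i ne_i]; rewrite !mxE.
  rewrite -val_eqE /= prednK // eqxx ltn_eqF ?prednK // mulr1.
  by congr (v _ _ _); lia.
case: eqP => _; rewrite ?mulr0 //.
have /negbTE-> : i.+1 != j.
  by apply: contraNneq ne_i => e; apply/eqP/val_inj; rewrite /= -e.
by rewrite mulr0.
Qed.

(** Write the minimal polynomial of A as (X - a)^k q with q(a) <> 0, and put
    N = A - a and Q = q(A).  Then Q N^k = 0, whereas Q N^(k-1) Q <> 0 because
    (X - a)^(k-1) q^2 is not a multiple of the minimal polynomial.  So some row
    v of Q and column g of Q satisfy v N^(k-1) g <> 0, v N^k = 0 and N^k g = 0.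
    The chain v, v N, ..., v N^(k-1) carries the Jordan block, the chain
    N^(k-1) g, ..., N g, g defines an invariant complement, and their products
    form a triangular matrix with v N^(k-1) g on the diagonal. *)
Lemma split_jordan_block n (A : 'M[C]_n) :
  (0 < n)%N ->
  exists k m (a : C) (V : 'M[C]_(k, n)) (W : 'M[C]_(m, n)) (A' : 'M[C]_m),
    [/\ (0 < k)%N, (k + m)%N = n, row_free (col_mx V W),
        V *m A = jordan_block k a *m V & W *m A = A' *m W].
Proof.
case: n A => // n A _.
have [a ra] : exists a, root (mxminpoly A) a.
  apply/closed_rootP; rewrite size_mxminpoly.
  by case: degree_mxminpoly (mxminpoly_nonconstant A).
have pA_neq0 : mxminpoly A != 0 by rewrite monic_neq0 ?mxminpoly_monic.
have [k [q]] := multiplicity_XsubC (mxminpoly A) a.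
rewrite pA_neq0 /= => nrq def_p.
have k_gt0 : (0 < k)%N.
  by case: k def_p => // def_p; rewrite def_p expr0 mulr1 (negbTE nrq) in ra.
pose N := A - a%:M; pose Q := horner_mx A q.
have def_N : horner_mx A ('X - a%:P) = N.
  by rewrite rmorphB /= horner_mx_X horner_mx_C.
have QN0 : Q *m N ^+ k = 0.
  rewrite -def_N -rmorphXn -[_ *m _]rmorphM -def_p.
  exact/mxminpoly_minP.
have QN_comm i : Q *m N ^+ i = N ^+ i *m Q.
  by rewrite -def_N -rmorphXn -![_ *m _]rmorphM mulrC.
(* After cancelling (X - a)^(k-1) q, divisibility would make a a root of q. *)
have [i0 [j0 nz]] : exists i j, (Q *m N ^+ k.-1 *m Q) i j != 0.
  apply/matrix0Pn.
  rewrite -def_N -rmorphXn -[Q *m _]rmorphM -[_ *m Q]rmorphM -dvd_mxminpoly.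
  rewrite def_p -{1}(prednK k_gt0) exprS mulrCA mulrC.
  rewrite dvdp_mul2l ?dvdp_XsubCl //.
  rewrite mulf_neq0 ?expf_neq0 ?polyXsubC_eq0 //.
  by apply: contraNneq nrq => ->; rewrite root0.
pose v i : 'rV_n.+1 := row i0 Q *m N ^+ i.
pose g i : 'cV_n.+1 := N ^+ i *m col j0 Q.
have vk0 : v k = 0 by rewrite /v -row_mul QN0 row0.
have gk0 : g k = 0 by rewrite /g colE mulmxA -QN_comm QN0 mul0mx.
pose V := \matrix_(i < k) v i.
pose G := \matrix_(l < n.+1, j < k) g (k.-1 - j)%N l 0.
have vN i : v i *m N = v i.+1 by rewrite /v -mulmxA exprSr.
have gN i : N *m g i = g i.+1 by rewrite /g mulmxA exprS.
have vg i j : (v i *m g j) 0 0 = (Q *m N ^+ (i + j) *m Q) i0 j0.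
  rewrite /v /g mulmxA -[_ *m N ^+ j]mulmxA -[N ^+ i *m _]exprD.
  by rewrite -row_mul colE mulmxA -row_mul -colE !mxE.
have defA : A = a%:M + N by rewrite addrC subrK.
have VA : V *m A = jordan_block k a *m V.
  rewrite {1}defA jordan_blockE mulmxDr mulmxDl mul_mx_scalar mul_scalar_mx.
  congr (_ + _); rewrite mul_jordan_block0 //.
  by apply/row_matrixP=> i; rewrite row_mul !rowK vN.
have AG : A *m G = G *m jordan_block k a.
  rewrite {1}defA jordan_blockE mulmxDr mulmxDl mul_mx_scalar mul_scalar_mx.
  congr (_ + _); rewrite mul_mx_jordan_block0 //.
  apply/matrixP=> l j; rewrite mxE [RHS]mxE.
  have -> : (k - j = (k.-1 - j).+1)%N by have := ltn_ord j; lia.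
  by rewrite -gN [RHS]mxE; apply: eq_bigr => i _; rewrite [G _ _]mxE.
have VGE i j : (V *m G) i j = (Q *m N ^+ (i + (k.-1 - j)) *m Q) i0 j0.
  rewrite -vg [LHS]mxE [RHS]mxE; apply: eq_bigr => l _.
  by rewrite [V _ _]mxE [G _ _]mxE.
have uVG : V *m G \in unitmx.
  rewrite unitmxE unitfE -det_tr det_trig.
    apply/prodf_neq0 => i _; rewrite mxE VGE subnKC //.
    by rewrite -ltnS prednK.
  apply/is_trig_mxP=> i j lt_ij; rewrite mxE VGE.
  have le_k : (k <= j + (k.-1 - i))%N by have := ltn_ord i; lia.
  rewrite -(subnKC le_k) exprD.
  have -> : Q *m (N ^+ k * N ^+ (j + (k.-1 - i) - k)) = 0.
    by rewrite [LHS]mulmxA QN0 mul0mx.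
  by rewrite mul0mx mxE.
have [m [W [A' [km free WA]]]] := invariant_complement VA AG uVG.
by exists k, m, a, V, W, A'.
Qed.

(** Jordan matrices whose blocks are described by functions on nat: adding a
    block in front is then a case split on the index that computes, which it
    would not be for families over 'I_m. *)
Definition nat_jordan_mx n (J : 'M[C]_n) : Prop :=
  exists (m : nat) (k : nat -> nat) (a : nat -> C),
    (forall i, (0 < k i)%N) /\
    exists e : (\sum_(i < m) k i)%N = n,
      J = castmx (e, e) (\mxdiag_(i < m) jordan_block (k i) (a i)).

Lemma nat_jordan_is_jordan n (J : 'M[C]_n) : nat_jordan_mx J -> is_jordan_mx J.
Proof.
case=> m [k [a [k_gt0 [e ->]]]]; exists m, (fun i => k i), (fun i => a i).
by split=> //; exists e.
Qed.

Lemma nat_jordan_block_mx k m (a : C) (J : 'M[C]_m) :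
  (0 < k)%N -> nat_jordan_mx J ->
  nat_jordan_mx (block_mx (jordan_block k a) 0 0 J).
Proof.
move=> k_gt0 [p [ks [b [ks_gt0 [e ->]]]]].
case: m / e J => _; rewrite castmx_id.
exists p.+1, (fun i => if i is j.+1 then ks j else k).
exists (fun i => if i is j.+1 then b j else a); split; first by case.
exists (esym mxsize_recl); rewrite mxdiag_recl castmx_comp.
by rewrite castmx_id.
Qed.

Lemma jordan_form n (A : 'M[C]_n) :
  exists P J : 'M[C]_n,
    [/\ P \in unitmx, nat_jordan_mx J & P *m A = J *m P].
Proof.
have [N] := ubnP n; elim: N => // N IHN in n A *; rewrite ltnS => le_nN.
have [n0|n_gt0] := posnP n.
  exists 1%:M, A; rewrite unitmx1 mul1mx mulmx1; split=> //; subst n.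
  exists 0%N, (fun=> 1%N), (fun=> 0); split=> //.
  by exists (big_ord0 _ _ _ _); rewrite [LHS]flatmx0 [RHS]flatmx0.
have [k [m [a [V [W [A' [k_gt0 km free VA WA]]]]]]] :=
  split_jordan_block A n_gt0.
subst n; rewrite row_free_unit in free.
have lt_mN : (m < N)%N by rewrite (leq_trans _ le_nN) // -{1}[m]add0n ltn_add2r.
have [P' [J' [uP' jJ' PA']]] := IHN m A' lt_mN.
exists (block_mx 1%:M 0 0 P' *m col_mx V W).
exists (block_mx (jordan_block k a) 0 0 J').
split; last 1 first.
- rewrite -mulmxA [col_mx V W *m A]mul_col_mx VA WA.
  rewrite [RHS]mulmxA mulmx_block !mul_block_col.
  by rewrite !(mul0mx, mul1mx, mulmx0, mulmx1, addr0, add0r) !mulmxA PA'.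
- rewrite unitmx_mul free andbT unitmxE det_ublock det1 mul1r.
  by rewrite -unitmxE.
exact: nat_jordan_block_mx.
Qed.

End JordanForm.

(** * Double-complex matrices as pairs of complex matrices *)

Section Halves.
Variable R : realType.
Local Notation C := R[i].
Local Notation D := (dcomplex R).

(** The coordinates of a double-complex number on the idempotents (1 + j) / 2
    and (1 - j) / 2.  They are ring morphisms and jointly injective, so that
    identities between double-complex matrices can be checked on the
    images. *)
Definition dc_left (x : D) : C := dc_re x + dc_im x.
Definition dc_right (x : D) : C := dc_re x - dc_im x.

Fact dc_left_is_zmod : zmod_morphism dc_left.
Proof. by case=> a b [c d]; rewrite /dc_left /=; ring. Qed.
Fact dc_left_is_monoid : monoid_morphism dc_left.
Proof.
by split=> [|[a b] [c d]]; rewrite /dc_left /= ?addr0 //; ring.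
Qed.
Fact dc_right_is_zmod : zmod_morphism dc_right.
Proof. by case=> a b [c d]; rewrite /dc_right /=; ring. Qed.
Fact dc_right_is_monoid : monoid_morphism dc_right.
Proof.
by split=> [|[a b] [c d]]; rewrite /dc_right /= ?subr0 //; ring.
Qed.
HB.instance Definition _ :=
  GRing.isZmodMorphism.Build D C dc_left dc_left_is_zmod.
HB.instance Definition _ :=
  GRing.isMonoidMorphism.Build D C dc_left dc_left_is_monoid.
HB.instance Definition _ :=
  GRing.isZmodMorphism.Build D C dc_right dc_right_is_zmod.
HB.instance Definition _ :=
  GRing.isMonoidMorphism.Build D C dc_right dc_right_is_monoid.

Lemma dc_halves_inj (x y : D) :
  dc_left x = dc_left y -> dc_right x = dc_right y -> x = y.
Proof.
case: x y => [a b] [c d]; rewrite /dc_left /dc_right /= => e1 e2.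
have nz2 : (2 : C) != 0 by rewrite pnatr_eq0.
congr DComplex; apply: (mulIf nz2).
  by transitivity ((a + b) + (a - b)); [ring | rewrite e1 e2; ring].
by transitivity ((a + b) - (a - b)); [ring | rewrite e1 e2; ring].
Qed.

Lemma dc_unit2 : (2 : D) \is a GRing.unit.
Proof.
have nz2 : (2 : C) != 0 by rewrite pnatr_eq0.
apply/unitrPr; exists (dc_of 2^-1); apply: dc_halves_inj;
  rewrite rmorphM rmorph_nat rmorph1 /= /dc_left /dc_right /=.
  by rewrite addr0 mulfV.
by rewrite subr0 mulfV.
Qed.

Lemma map_dc_left_pairmx n (A B : 'M[C]_n) : map_mx dc_left (dc_pairmx A B) = A.
Proof.
have nz2 : (2 : C) != 0 by rewrite pnatr_eq0.
have leftj : dc_left (dc_j R) = 1 by rewrite /dc_left add0r.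
have left_of w : dc_left (dc_of w) = w by rewrite /dc_left addr0.
apply/matrixP=> i j; rewrite !mxE rmorphD !rmorphM rmorphV ?dc_unit2 //=.
rewrite rmorphD rmorphB /= !left_of leftj rmorph_nat.
by field.
Qed.

Lemma map_dc_right_pairmx n (A B : 'M[C]_n) :
  map_mx dc_right (dc_pairmx A B) = B^T.
Proof.
have nz2 : (2 : C) != 0 by rewrite pnatr_eq0.
have rightj : dc_right (dc_j R) = - 1 by rewrite /dc_right sub0r.
have right_of w : dc_right (dc_of w) = w by rewrite /dc_right subr0.
apply/matrixP=> i j; rewrite !mxE rmorphD !rmorphM rmorphV ?dc_unit2 //=.
rewrite rmorphD rmorphB /= !right_of rightj rmorph_nat.
by field.
Qed.

Lemma map_dc_halves_inj m n (M N : 'M[D]_(m, n)) :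
  map_mx dc_left M = map_mx dc_left N ->
  map_mx dc_right M = map_mx dc_right N -> M = N.
Proof.
move=> /matrixP eL /matrixP eR; apply/matrixP=> i j.
by apply: dc_halves_inj; [have := eL i j | have := eR i j]; rewrite !mxE.
Qed.

Definition map_pairmxE := (map_dc_left_pairmx, map_dc_right_pairmx).

Lemma mul_pairmx n (A B A' B' : 'M[C]_n) :
  dc_pairmx A B *m dc_pairmx A' B' = dc_pairmx (A *m A') (B' *m B).
Proof.
by apply: map_dc_halves_inj; rewrite map_mxM !map_pairmxE // trmx_mul.
Qed.

Lemma pairmx1 n : dc_pairmx 1%:M 1%:M = 1%:M :> 'M[D]_n.
Proof. by apply: map_dc_halves_inj; rewrite map_pairmxE map_mx1 ?trmx1. Qed.

Lemma adj_pairmx n (A B : 'M[C]_n) : dc_adjmx (dc_pairmx A B) = dc_pairmx B A.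
Proof.
apply: map_dc_halves_inj; rewrite map_pairmxE.
  rewrite -[RHS]trmxK -(map_dc_right_pairmx A B); apply/matrixP=> i j.
  by rewrite !mxE.
rewrite -[in RHS](map_dc_left_pairmx A B); apply/matrixP=> i j.
by rewrite !mxE /dc_right /= opprK.
Qed.

Lemma unitary_pairmx n (P : 'M[C]_n) :
  P \in unitmx -> dc_unitarymx (dc_pairmx P (invmx P)).
Proof.
by move=> uP; rewrite /dc_unitarymx adj_pairmx mul_pairmx mulVmx ?pairmx1.
Qed.

Lemma unit_pairmx n (A B : 'M[C]_n) :
  dc_pairmx A B \in unitmx -> A \in unitmx /\ B \in unitmx.
Proof.
move=> uM; rewrite -[A](map_dc_left_pairmx A B) -[in B \in _]unitmx_tr.
rewrite -(map_dc_right_pairmx A B) !unitmxE !det_map_mx.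
by rewrite !rmorph_unit -?unitmxE.
Qed.

End Halves.

Theorem theorem6p2 (R : realType) (n : nat) (A B : 'M[R[i]]_n)
    (M : 'M[dcomplex R]_n) (defM : M = dc_pairmx A B) :
  M \in unitmx -> has_jordan_svd M.
Proof.
rewrite defM => /unit_pairmx[uA uB].
have [S S2] : exists S, S *m S = A *m B.
  by apply: unitmx_sqrt; rewrite unitmx_mul uA.
have uS : S \in unitmx.
  have : S *m S \in unitmx by rewrite S2 unitmx_mul uA.
  by rewrite unitmx_mul => /andP[].
have [P [J [uP jJ PS]]] := jordan_form S.
have defJ : J = P *m S *m invmx P by rewrite PS mulmxK.
have uJ : J \in unitmx by rewrite defJ !unitmx_mul unitmx_inv uP uS.
(* Jordan forms come as P S = J P, so the conjugating X is the inverse of P. *)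
pose X := invmx P; pose Y := invmx A *m X *m J.
have uY : Y \in unitmx by rewrite !unitmx_mul !unitmx_inv uA uP.
exists (dc_pairmx X (invmx X)), (dc_pairmx Y (invmx Y)), J; split.
- by apply: unitary_pairmx; rewrite unitmx_inv.
- exact: unitary_pairmx.
- exact: nat_jordan_is_jordan.
rewrite adj_pairmx !mul_pairmx; congr dc_pairmx.
  apply: (can_inj (mulmxK uY)); rewrite mulmxKV //.
  by rewrite /Y !mulmxA mulmxV // mul1mx.
rewrite invmxK /Y !mulmxA -[_ *m J *m J]mulmxA.
have J2 : J *m J = P *m (A *m B) *m invmx P.
  have PJ : invmx P *m J = S *m invmx P by rewrite defJ !mulmxA mulVmx ?mul1mx.
  by rewrite {1}defJ -mulmxA PJ -S2 !mulmxA.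
by rewrite J2 !mulmxA mulmxKV // mulmxKV // mulVmx // mul1mx.
Qed.
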